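(* Let $p$ be a prime number, let $V$ be a commutative ring, let $\varpi \in V$ be a regular element (nonzerodivisor) with a compatible system of $p$-power roots $\{\varpi^{1/p^n}\}_{n\ge 0}$ in $V$, and let $I=\bigcup_{n>0}(\varpi^{1/p^n})$, so that $(V,I)$ is a basic setup. Let $M$ be an $I$-almost finitely generated $V$-module that is $I$-almost projective. Let $\phi: N\to M$ be a homomorphism of $V$-modules such that $\mathrm{Coker}(\phi)$ is killed by $\varpi^{\alpha}$ for a fixed positive rational number $\alpha\in\mathbf{Z}[1/p]$. Then for every integer $k>0$ there exists a $V$-module homomorphism $g: M\to N$ such that $$\phi\circ g=\varpi^{\frac{1}{p^k}+2\alpha}\,\mathrm{id}_M .$$
   Context: A basic setup $(V,I)$ is a commutative ring $V$ with an ideal $I$ such that $I^2=I$ and $I\otimes_V I$ is flat over $V$. A compatible system of $p$-power roots means $\varpi^{1/p^0}=\varpi$ and $(\varpi^{1/p^{n+1}})^p=\varpi^{1/p^n}$ for all $n\ge 0$; for $\alpha=a/p^n$ with integers $a> 0$, $n\ge 0$, one sets $\varpi^\alpha=(\varpi^{1/p^n})^a$. Let $M$ be a $V$-module. - $M$ is $I$-almost zero, written $M\approx 0$, if $IM=0$. - $M$ is $I$-almost finitely generated if for every finitely generated ideal $I_0\subseteq I$ there exist a finitely generated $V$-module $M_0$ and a $V$-linear map $f_0:M_0\to M$ whose kernel and cokernel are annihilated by $I_0$. - $M$ is $I$-almost projective if $\mathrm{Ext}^i_V(M,N)\approx 0$ for every $V$-module $N$ and every $i>0$. *)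

(* Defs.v *)
From HB Require Import structures.
From mathcomp Require Import all_boot all_order all_algebra.
From mathcomp Require Import boolp classical_sets functions cardinality fsbigop.

Set Implicit Arguments.
Unset Strict Implicit.
Unset Printing Implicit Defensive.

Import Order.TTheory GRing.Theory Num.Theory.
Local Open Scope classical_set_scope.
Local Open Scope quotient_scope.
Local Open Scope ring_scope.

(* Base rings are comPzRingType, so the zero ring is allowed, as in the usual
   meaning of "commutative ring". *)

Section Submodule.
Variables (V : comPzRingType) (U : lmodType V) (S : submodClosed U).

Record submod := Submod { submod_val :> U; submod_valP : submod_val \in S }.

HB.instance Definition _ := [isSub for submod_val].
HB.instance Definition _ := [Choice of submod by <:].
HB.instance Definition _ :=
  GRing.SubChoice_isSubLmodule.Build V U (mem S) submod (submodClosedP S).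
End Submodule.

Section Quotient.
Variables (V : comPzRingType) (U : lmodType V) (S : submodClosed U).

Let memN x : (- x \in S) = (x \in S).
Proof.
rewrite -scaleN1r; apply/idP/idP => /(rpredZ (-1)) //.
by rewrite scalerA mulrNN mulr1 scale1r.
Qed.

Definition quot_rel : rel U := fun x y => x - y \in S.

Lemma quot_rel_refl : reflexive quot_rel.
Proof. by move=> x; rewrite /quot_rel subrr rpred0. Qed.

Lemma quot_rel_sym : symmetric quot_rel.
Proof. by move=> x y; rewrite /quot_rel -opprB memN. Qed.

Lemma quot_rel_trans : transitive quot_rel.
Proof.
move=> y x z xy yz; rewrite /quot_rel -(subrK y x) -addrA.
exact: rpredD.
Qed.

Canonical quot_equiv := EquivRel quot_rel quot_rel_refl quot_rel_sym
  quot_rel_trans.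

Definition quotmod := {eq_quot quot_rel}.
HB.instance Definition _ := Choice.on quotmod.

Definition quot_pi : U -> quotmod := fun x => \pi_quotmod x.

Lemma quot_piP x y : quot_pi x = quot_pi y <-> x - y \in S.
Proof. by rewrite /quot_pi; split => [/eqmodP|h] //; exact/eqmodP. Qed.

Lemma quot_pi_surj (q : quotmod) : exists x, quot_pi x = q.
Proof. by exists (repr q); rewrite /quot_pi reprK. Qed.

Let rep (q : quotmod) : U := repr q.

Let repK q : quot_pi (rep q) = q.
Proof. by rewrite /quot_pi /rep reprK. Qed.

Definition quot_add (q r : quotmod) := quot_pi (rep q + rep r).
Definition quot_opp (q : quotmod) := quot_pi (- rep q).
Definition quot_scale (a : V) (q : quotmod) := quot_pi (a *: rep q).

Let rep_pi x : rep (quot_pi x) - x \in S.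
Proof. by apply/quot_piP; rewrite repK. Qed.

Let pi_add x y : quot_add (quot_pi x) (quot_pi y) = quot_pi (x + y).
Proof. by apply/quot_piP; rewrite opprD addrACA rpredD ?rep_pi. Qed.

Let pi_opp x : quot_opp (quot_pi x) = quot_pi (- x).
Proof. by apply/quot_piP; rewrite -opprD memN rep_pi. Qed.

Let pi_scale a x : quot_scale a (quot_pi x) = quot_pi (a *: x).
Proof. by apply/quot_piP; rewrite -scalerBr rpredZ ?rep_pi. Qed.

Let quot_addA : associative quot_add.
Proof.
by move=> x y z; rewrite -(repK x) -(repK y) -(repK z) !pi_add addrA.
Qed.

Let quot_addC : commutative quot_add.
Proof. by move=> x y; rewrite -(repK x) -(repK y) !pi_add addrC. Qed.

Let quot_add0 : left_id (quot_pi 0) quot_add.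
Proof. by move=> x; rewrite -(repK x) pi_add add0r. Qed.

Let quot_addN : left_inverse (quot_pi 0) quot_opp quot_add.
Proof. by move=> x; rewrite -(repK x) pi_opp pi_add addNr. Qed.

HB.instance Definition _ :=
  GRing.isZmodule.Build quotmod quot_addA quot_addC quot_add0 quot_addN.

Let pi_addE x y : quot_pi x + quot_pi y = quot_pi (x + y).
Proof. exact: pi_add. Qed.

Let quot_scaleA a b q : quot_scale a (quot_scale b q) = quot_scale (a * b) q.
Proof. by rewrite -(repK q) !pi_scale scalerA. Qed.

Let quot_scale1 : left_id 1 quot_scale.
Proof. by move=> q; rewrite -(repK q) pi_scale scale1r. Qed.

Let quot_scaleDr : right_distributive quot_scale +%R.
Proof.
move=> a q r; rewrite -(repK q) -(repK r).
by rewrite pi_addE !pi_scale pi_addE scalerDr.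
Qed.

Let quot_scaleDl q : {morph quot_scale^~ q : a b / a + b}.
Proof.
by move=> a b; rewrite -(repK q) !pi_scale pi_addE scalerDl.
Qed.

HB.instance Definition _ := GRing.Zmodule_isLmodule.Build V quotmod
  quot_scaleA quot_scale1 quot_scaleDr quot_scaleDl.

Lemma quot_pi_is_linear : linear quot_pi.
Proof. move=> a x y; rewrite -pi_addE; congr (_ + _).
by rewrite -[RHS]/(quot_scale a _) pi_scale. Qed.

HB.instance Definition _ :=
  GRing.isLinear.Build V U quotmod *:%R quot_pi quot_pi_is_linear.

Lemma quot_pi_eq0 x : quot_pi x = 0 <-> x \in S.
Proof. by rewrite -(linear0 quot_pi) quot_piP subr0. Qed.
End Quotient.

Section KernelCokernel.
Variables (V : comPzRingType) (A B : lmodType V) (f : {linear A -> B}).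

Definition ker_pred : {pred A} := [pred x | f x == 0].

Lemma ker_pred_closed : submod_closed ker_pred.
Proof.
split=> [|a x y]; rewrite !inE ?linear0 // => /eqP fx /eqP fy.
by rewrite linearP fx fy scaler0 addr0.
Qed.

HB.instance Definition _ := GRing.isSubmodClosed.Build V A ker_pred
  ker_pred_closed.

Definition im_pred : {pred B} := [pred y | `[< exists x, f x = y >]].

Lemma im_pred_closed : submod_closed im_pred.
Proof.
split=> [|a x y].
  by apply/asboolP; exists 0; rewrite linear0.
move=> /asboolP[u <-] /asboolP[v <-]; apply/asboolP.
by exists (a *: u + v); rewrite linearP.
Qed.

HB.instance Definition _ := GRing.isSubmodClosed.Build V B im_pred
  im_pred_closed.

Definition Ker : lmodType V := submod ker_pred.
Definition Coker : lmodType V := quotmod im_pred.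
End KernelCokernel.

Lemma linear_eq (V : comPzRingType) (A B : lmodType V) (f g : {linear A -> B}) :
  f =1 g -> f = g.
Proof.
case: f g => [f [[fa] [fz]]] [g [[ga] [gz]]] /= fg.
have {}fg : f = g by apply/funext.
rewrite {}fg in fa fz *.
by rewrite (Prop_irrelevance fa ga) (Prop_irrelevance fz gz).
Qed.

Section LinHom.
Variables (V : comPzRingType) (A B : lmodType V).

Definition linHom := {linear A -> B}.

HB.instance Definition _ := gen_eqMixin linHom.
HB.instance Definition _ := gen_choiceMixin linHom.

Definition hom_zero : linHom := (\0 : A -> B).
Definition hom_opp (f : linHom) : linHom := \- f.
Definition hom_add (f g : linHom) : linHom := f \+ g.
Definition hom_scale (a : V) (f : linHom) : linHom := a \*: f.

Let hom_addA : associative hom_add.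
Proof. by move=> f g h; apply: linear_eq => x /=; rewrite addrA. Qed.

Let hom_addC : commutative hom_add.
Proof. by move=> f g; apply: linear_eq => x /=; rewrite addrC. Qed.

Let hom_add0 : left_id hom_zero hom_add.
Proof. by move=> f; apply: linear_eq => x /=; rewrite add0r. Qed.

Let hom_addN : left_inverse hom_zero hom_opp hom_add.
Proof. by move=> f; apply: linear_eq => x /=; rewrite addNr. Qed.

HB.instance Definition _ :=
  GRing.isZmodule.Build linHom hom_addA hom_addC hom_add0 hom_addN.

Let hom_scaleA a b f : hom_scale a (hom_scale b f) = hom_scale (a * b) f.
Proof. by apply: linear_eq => x /=; rewrite scalerA. Qed.

Let hom_scale1 : left_id 1 hom_scale.
Proof. by move=> f; apply: linear_eq => x /=; rewrite scale1r. Qed.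

Let hom_scaleDr : right_distributive hom_scale +%R.
Proof. by move=> a f g; apply: linear_eq => x /=; rewrite scalerDr. Qed.

Let hom_scaleDl f : {morph hom_scale^~ f : a b / a + b}.
Proof. by move=> a b; apply: linear_eq => x /=; rewrite scalerDl. Qed.

HB.instance Definition _ := GRing.Zmodule_isLmodule.Build V linHom
  hom_scaleA hom_scale1 hom_scaleDr hom_scaleDl.
End LinHom.

Section HomPrecomp.
Variables (V : comPzRingType) (A B N : lmodType V) (u : {linear A -> B}).

Definition hom_precomp (f : linHom B N) : linHom A N := (f \o u : {linear A -> N}).

Lemma hom_precomp_is_linear : linear hom_precomp.
Proof. by move=> a f g; apply: linear_eq. Qed.

HB.instance Definition _ := GRing.isLinear.Build V (linHom B N) (linHom A N) *:%R
  hom_precomp hom_precomp_is_linear.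
End HomPrecomp.

Definition projective (V : comPzRingType) (P : lmodType V) :=
  forall (X Y : lmodType V) (g : {linear X -> Y}) (f : {linear P -> Y}),
    (forall y, exists x, g x = y) ->
    exists h : {linear P -> X}, forall x, g (h x) = f x.

(* The free module on T: functions T -> V of finite support. *)
Section Free.
Variables (V : comPzRingType) (T : choiceType).

Definition fin_supp : {pred T -> V^o} :=
  [pred f | `[< finite_set [set t | f t != 0] >]].

Lemma fin_supp_closed : submod_closed fin_supp.
Proof.
split=> [|a f g].
  apply/asboolP; suff -> : [set t | (0 : T -> V^o) t != 0] = set0 by [].
  by rewrite -subset0 => t /=; rewrite eqxx.
move=> /asboolP ff /asboolP fg; apply/asboolP.
apply: (@sub_finite_set _ _ ([set t | f t != 0] `|` [set t | g t != 0])).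
  move=> t /= h; apply: contrapT => /not_orP[/negP/negPn/eqP ft].
  move=> /negP/negPn/eqP gt; move: h.
  have -> : (a *: f + g) t = 0.
    by rewrite -[LHS]/(a *: f t + g t) ft gt scaler0 addr0.
  by rewrite eqxx.
by rewrite finite_setU.
Qed.

HB.instance Definition _ := GRing.isSubmodClosed.Build V (T -> V^o) fin_supp
  fin_supp_closed.

Definition Free : lmodType V := submod fin_supp.

Lemma free_suppP (s : seq Free) : exists2 r : seq T, uniq r &
  forall f t, f \in s -> t \notin r -> submod_val f t = 0.
Proof.
elim: s => [|f s [r ur rP]]; first by exists [::].
have /asboolP/finite_seqP[r' r'P] := submod_valP f.
exists (undup (r' ++ r)); first exact: undup_uniq.
move=> g t; rewrite inE mem_undup mem_cat negb_or => /predU1P[->|gs] /andP[tr' tr].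
  apply/eqP; apply: contraT => ft.
  by have : [set` r'] t by [rewrite -r'P]; rewrite /= (negPf tr').
exact: rP.
Qed.

Definition delta_fun (t : T) : T -> V^o := fun u => if u == t then 1 else 0.

Lemma scale_delta_fun (a : V) t u : (a *: delta_fun t) u = if u == t then a else 0.
Proof.
rewrite -[LHS]/(a *: delta_fun t u) /delta_fun.
by case: eqP => _; [exact: mulr1 | exact: scaler0].
Qed.

Lemma delta_fun_supp t : delta_fun t \in fin_supp.
Proof.
apply/asboolP; apply: (@sub_finite_set _ _ [set t]) => // u /=.
by apply: contraNeq => /negPf ut; rewrite /delta_fun ut.
Qed.

Definition free_delta t : Free := Submod (delta_fun_supp t).

Section Lift.
Variables (N : lmodType V) (h : T -> N).

Definition free_lift (f : Free) : N :=
  \sum_(t \in [set: T]) (submod_val f t : V) *: h t.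

Lemma free_liftE (r : seq T) (f : Free) : uniq r ->
  (forall t, t \notin r -> submod_val f t = 0) ->
  free_lift f = \sum_(t <- r) (submod_val f t : V) *: h t.
Proof.
move=> ur rP; rewrite /free_lift (@fsbigE _ _ _ _ _ r) //.
  by apply: eq_bigl => t; rewrite in_setT.
by move=> t _ tr; rewrite rP // scale0r.
Qed.

Lemma free_lift_is_linear : linear free_lift.
Proof.
move=> a f g; have [r ur rP] := free_suppP [:: a *: f + g; f; g].
rewrite !(@free_liftE r) //; try by move=> t; apply: rP; rewrite !inE eqxx ?orbT.
rewrite scaler_sumr -big_split /=; apply: eq_bigr => t _.
by rewrite scalerA -scalerDl.
Qed.

HB.instance Definition _ := GRing.isLinear.Build V Free N *:%R free_lift
  free_lift_is_linear.

Lemma free_lift_delta t : free_lift (free_delta t) = h t.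
Proof.
rewrite (@free_liftE [:: t]) //=.
  by rewrite big_seq1 /delta_fun eqxx scale1r.
by move=> u; rewrite inE /delta_fun => /negPf ->.
Qed.
End Lift.

Lemma free_hom_eq (N : lmodType V) (f g : {linear Free -> N}) :
  (forall t, f (free_delta t) = g (free_delta t)) -> f =1 g.
Proof.
move=> fg x; have [r ur rP] := free_suppP [:: x].
have -> : x = \sum_(t <- r) (submod_val x t : V) *: free_delta t.
  apply: val_inj; rewrite raddf_sum /=; apply/funext => u.
  rewrite fct_sumE.
  have [ur'|ur'] := boolP (u \in r); last first.
    rewrite rP ?inE // big1_seq // => t /andP[_ tr].
    have /negPf ut : u != t by apply: contraNneq ur' => ->.
    by rewrite scale_delta_fun ut.
  rewrite (bigD1_seq u) //= big1 ?addr0.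
    by rewrite scale_delta_fun eqxx.
  by move=> t tu; rewrite scale_delta_fun eq_sym (negPf tu).
by rewrite !linear_sum; apply: eq_bigr => t _; rewrite !linearZ /= fg.
Qed.

Lemma Free_projective : projective Free.
Proof.
move=> X Y g f gsurj.
have /choice[h hP] : forall t, exists x, g x = f (free_delta t).
  by move=> t; exact: gsurj.
exists (free_lift h) => x.
apply: (@free_hom_eq _ (g \o free_lift h : {linear Free -> Y}) f) => t.
by rewrite /= free_lift_delta hP.
Qed.
End Free.

Record proj_resolution (V : comPzRingType) (M : lmodType V) := ProjResolution {
  res_obj : nat -> lmodType V;
  res_d : forall n, {linear res_obj n.+1 -> res_obj n};
  res_aug : {linear res_obj 0 -> M};
  res_proj : forall n, projective (res_obj n);
  res_aug_surj : forall m, exists x, res_aug x = m;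
  res_exact0 : forall x, res_aug x = 0 <-> exists y, res_d 0 y = x;
  res_exactS : forall n x, res_d n x = 0 <-> exists y, res_d n.+1 y = x
}.

Section FreeResolution.
Variables (V : comPzRingType) (M : lmodType V).

Definition free_cover (X : lmodType V) : {linear Free V X -> X} :=
  free_lift (id : X -> X).

Lemma free_cover_surj (X : lmodType V) (m : X) : exists x, free_cover X x = m.
Proof. by exists (free_delta V m); rewrite /free_cover /= free_lift_delta. Qed.

Fixpoint syzygy (n : nat) : lmodType V :=
  if n is n'.+1 then Ker (free_cover (syzygy n')) else M.

Definition free_d (n : nat) :
    {linear Free V (syzygy n.+1) -> Free V (syzygy n)} :=
  (val : Ker (free_cover (syzygy n)) -> _) \o free_cover (syzygy n.+1).

Lemma free_d_exact n (x : Free V (syzygy n)) :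
  free_cover (syzygy n) x = 0 <-> exists y, free_d n y = x.
Proof.
split=> [/eqP x0|[y <-]]; last first.
  by apply/eqP; exact: (submod_valP (free_cover (syzygy n.+1) y)).
have [y yE] := free_cover_surj
  (Submod (x0 : x \in ker_pred (free_cover (syzygy n))) : syzygy n.+1).
by exists y; rewrite /free_d /= yE.
Qed.

Lemma free_d_exactS n x : free_d n x = 0 <-> exists y, free_d n.+1 y = x.
Proof.
rewrite -free_d_exact; split=> [x0|]; last by rewrite /free_d /= => ->.
exact: val_inj.
Qed.

Definition free_resolution : proj_resolution M :=
  @ProjResolution V M (fun n => Free V (syzygy n)) free_d (free_cover M)
    (fun n => @Free_projective V (syzygy n)) (@free_cover_surj M)
    (@free_d_exact 0) free_d_exactS.
End FreeResolution.

(* The cohomology of the complex Hom(P, N) for a projective resolution P. *)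
Section Ext.
Variables (V : comPzRingType) (M : lmodType V) (P : proj_resolution M).
Variable N : lmodType V.

Definition ext_cochain (i : nat) : lmodType V := linHom (res_obj P i) N.

Definition ext_diff (i : nat) : {linear ext_cochain i -> ext_cochain i.+1} :=
  @hom_precomp V _ _ N (res_d P i).

(* For i > 0, the i-coboundaries are the image of ext_boundary i.-1, which is
   ext_diff i.-1 with its codomain restricted to the i-cocycles. *)
Definition ext_cocycle (i : nat) : lmodType V := Ker (ext_diff i).

Lemma ext_diffK i (h : ext_cochain i) : ext_diff i h \in ker_pred (ext_diff i.+1).
Proof.
apply/eqP/linear_eq => x /=.
have -> : res_d P i (res_d P i.+1 x) = 0 by apply/res_exactS; exists x.
by rewrite linear0.
Qed.

Definition ext_boundary (i : nat) (h : ext_cochain i) : ext_cocycle i.+1 :=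
  Submod (ext_diffK h).

Lemma ext_boundary_is_linear i : linear (@ext_boundary i).
Proof. by move=> a g h; apply: val_inj; exact: (linearP (ext_diff i)). Qed.

HB.instance Definition _ i := GRing.isLinear.Build V (ext_cochain i)
  (ext_cocycle i.+1) *:%R (@ext_boundary i) (@ext_boundary_is_linear i).

Definition Ext_res (i : nat) : lmodType V :=
  if i is i'.+1 then Coker (@ext_boundary i') else ext_cocycle 0.
End Ext.

(* Ext groups do not depend on the projective resolution; the one used is the
   functorial free resolution, whose n-th term is free on the underlying set of
   the n-th syzygy. *)
Definition Ext (V : comPzRingType) (i : nat) (M N : lmodType V) : lmodType V :=
  Ext_res (free_resolution M) N i.

Definition annihilates (V : comPzRingType) (J : set V) (X : lmodType V) :=
  forall (a : V) (x : X), J a -> a *: x = 0.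

Definition lin_span (V : comPzRingType) (X : lmodType V) (s : seq X) : set X :=
  [set x | exists c : 'I_(size s) -> V, x = \sum_(i < size s) c i *: s`_i].

Definition fin_gen (V : comPzRingType) (X : lmodType V) :=
  exists s : seq X, lin_span s = [set: X].

Definition ideal_gen (V : comPzRingType) (s : seq V) : set V :=
  lin_span (s : seq V^o).

Definition fin_gen_ideal (V : comPzRingType) (J : set V) :=
  exists s : seq V, J = ideal_gen s.

Definition almost_zero (V : comPzRingType) (I : set V) (X : lmodType V) :=
  annihilates I X.

Definition almost_fin_gen (V : comPzRingType) (I : set V) (M : lmodType V) :=
  forall I0 : set V, fin_gen_ideal I0 -> I0 `<=` I ->
    exists (M0 : lmodType V) (f0 : {linear M0 -> M}),
      [/\ fin_gen M0, annihilates I0 (Ker f0) & annihilates I0 (Coker f0)].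

Definition almost_projective (V : comPzRingType) (I : set V) (M : lmodType V) :=
  forall (N : lmodType V) (i : nat), (0 < i)%N -> almost_zero I (Ext i M N).

(* r n stands for varpi^{1/p^n}. *)
Definition compatible_roots (V : comPzRingType) (p : nat) (varpi : V)
    (r : nat -> V) :=
  r 0 = varpi /\ forall n, r n.+1 ^+ p = r n.

Definition roots_ideal (V : comPzRingType) (r : nat -> V) : set V :=
  \bigcup_(n in [set n | (0 < n)%N]) ideal_gen [:: r n].

(* alpha lies in Z[1/p] *)
Definition in_Z_inv (p : nat) (alpha : rat) :=
  exists (a : int) (n : nat), alpha = a%:~R / p%:R ^+ n.

(* varpi^alpha. For alpha > 0 in Z[1/p], the denominator of alpha is p ^ n and its numerator
   is a > 0 with alpha = a / p ^ n in lowest terms; root_powE below shows that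
   any other such fraction gives the same value. *)
Definition root_pow (V : comPzRingType) (p : nat) (r : nat -> V) (alpha : rat) :
    V :=
  r (logn p `|denq alpha|%N) ^+ `|numq alpha|%N.

Lemma root_powE (V : comPzRingType) (p : nat) (varpi : V) (r : nat -> V)
    (a n : nat) : prime p -> compatible_roots p varpi r -> (0 < a)%N ->
  root_pow p r (a%:R / p%:R ^+ n) = r n ^+ a.
Proof.
move=> p_pr [_ rS] a_gt0.
have rD m k : r (m + k)%N ^+ (p ^ k) = r m.
  elim: k => [|k IHk]; first by rewrite addn0.
  by rewrite addnS expnS exprM rS.
set alpha := _ / _.
pose d := `|denq alpha|%N; pose b := `|numq alpha|%N.
have p_gt0 := prime_gt0 p_pr.
have alpha_gt0 : 0 < alpha.
  by rewrite divr_gt0 ?exprn_gt0 ?ltr0n.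
have bE : numq alpha = b%:Z by rewrite /b gez0_abs // numq_ge0 ltW.
have dE : denq alpha = d%:Z by rewrite /d gez0_abs // denq_ge0.
have d_gt0 : (0 < d)%N by rewrite -ltz_nat -dE denq_gt0.
have cop : coprime b d by exact: coprime_num_den.
have E : (a * d = b * p ^ n)%N.
  apply/eqP; rewrite -(@eqr_nat rat) !natrM natrX.
  have : alpha = b%:R / d%:R by rewrite -[LHS]divq_num_den bE dE.
  have pn0 : p%:R ^+ n != 0 :> rat by rewrite expf_neq0 // pnatr_eq0 -lt0n.
  have d0 : d%:R != 0 :> rat by rewrite pnatr_eq0 -lt0n.
  by move=> /eqP; rewrite /alpha eqr_div // => /eqP ->.
have /(dvdn_pfactor _ _ p_pr)[m le_mn dm] : (d %| p ^ n)%N.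
  by rewrite -(Gauss_dvdr _ (_ : coprime d b)) 1?coprime_sym // -E dvdn_mull.
rewrite /root_pow -/d -/b dm pfactorK //.
have -> : a = (b * p ^ (n - m))%N.
  apply/eqP; rewrite -(eqn_pmul2r d_gt0) E dm -mulnA -expnD subnK //.
have := rD m (n - m)%N; rewrite subnKC // => rn.
by rewrite [in RHS]mulnC exprM rn.
Qed.

(* Main.v *)
Require Import Defs.
From HB Require Import structures.
From mathcomp Require Import all_boot all_order all_algebra.
From mathcomp Require Import boolp classical_sets.
From mathcomp Require Import ring.

Set Implicit Arguments.
Unset Strict Implicit.
Unset Printing Implicit Defensive.

Import Order.TTheory GRing.Theory Num.Theory.
Local Open Scope classical_set_scope.
Local Open Scope ring_scope.

(** Put [t := root_pow p r alpha].  Since [t] kills the cokernel of [phi],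
    multiplication by [t] on [M] takes its values in the image of [phi].  The
    obstruction to lifting it along [N -> im phi] is a class in
    [Ext^1 (M, Ker phi)], and almost projectivity says that [r k] kills this
    class.  Hence [r k * t] times the identity lifts to a map [g] with
    [phi \o g = r k * t] ([scaled_lift]), and [t *: g] has the required
    property because fractional powers multiply by adding their exponents
    ([root_pow_add_double]).

    The lift is made concrete on the free resolution
    [... -> F1 -> F0 -> M -> 0].  The map to be lifted, pulled back to [F0],
    lifts to some [h : F0 -> N]; on the syzygies [Ker (F0 -> M)] it takes
    values in [Ker phi], and this restriction, pulled back to [F1], is the
    cocycle of the obstruction.  Writing [a] times it as the coboundary of [b]
    makes [a *: h - b] vanish on syzygies, hence descend to [M]. *)

Section LinearMaps.
Variables (V : comPzRingType) (X Y Z : lmodType V).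

Lemma linear_descent (q : {linear X -> Y}) (u : {linear X -> Z}) :
  (forall y, exists x, q x = y) -> (forall x, q x = 0 -> u x = 0) ->
  exists g : {linear Y -> Z}, forall x, g (q x) = u x.
Proof.
move=> /choice[s sK] u0.
have uE x x' : q x = q x' -> u x = u x'.
  move=> e; apply/eqP; rewrite -subr_eq0 -linearB; apply/eqP/u0.
  by rewrite linearB /= e subrr.
have g_lin : linear (u \o s).
  by move=> a y y' /=; rewrite -linearP; apply: uE; rewrite linearP /= !sK.
pose g : {linear Y -> Z} := HB.pack (u \o s) (GRing.isLinear.Build _ _ _ _ _ g_lin).
by exists g => x /=; apply: uE; rewrite sK.
Qed.

Lemma linear_to_ker (phi : {linear Y -> Z}) (u : {linear X -> Y}) :
  (forall x, phi (u x) = 0) ->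
  exists c : {linear X -> Ker phi}, forall x, val (c x) = u x.
Proof.
move=> u0.
have uP x : u x \in ker_pred phi by apply/eqP.
have c_lin : linear (fun x => Submod (uP x) : Ker phi).
  by move=> a x y; apply: val_inj; rewrite /= linearP.
pose c : {linear X -> Ker phi} :=
  HB.pack (fun x => Submod (uP x) : Ker phi) (GRing.isLinear.Build _ _ _ _ _ c_lin).
by exists c.
Qed.

End LinearMaps.

(** Unfolds what it means for [a] to kill [Ext^1] on the free resolution: [a]
    times any cocycle is a coboundary. *)
Lemma Ext1_coboundary (V : comPzRingType) (M K : lmodType V) (a : V)
    (c : {linear Free V (syzygy M 1) -> K}) :
  annihilates [set a] (Ext 1 M K) ->
  (forall y, c (free_d M 1 y) = 0) ->
  exists b : {linear Free V M -> K}, forall y, b (free_d M 0 y) = a *: c y.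
Proof.
move=> aExt c0.
have cP : (c : ext_cochain (free_resolution M) K 1)
    \in ker_pred (ext_diff (free_resolution M) K 1).
  by apply/eqP/linear_eq => y; exact: c0.
pose z : ext_cocycle (free_resolution M) K 1 := Submod cP.
pose S := im_pred (@ext_boundary V M (free_resolution M) K 0).
have /quot_pi_eq0/asboolP[b bE] : quot_pi S (a *: z) = 0.
  by rewrite linearZ; apply: aExt.
exists b => y.
have /(congr1 (fun f : linHom _ _ => f y)) := congr1 val bE.
by [].
Qed.

(** Long exact sequence in disguise: the obstruction to lifting [f] along
    [phi] lies in [Ext^1 (M, Ker phi)], so a scalar that kills this group
    makes the lift possible. *)
Lemma scaled_lift (V : comPzRingType) (M N L : lmodType V)
    (phi : {linear N -> L}) (f : {linear M -> L}) (a : V) :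
  annihilates [set a] (Ext 1 M (Ker phi)) ->
  (forall m, exists n, phi n = f m) ->
  exists g : {linear M -> N}, forall m, phi (g m) = a *: f m.
Proof.
move=> aExt /choice[s sE].
have hE x : phi (free_lift s x) = f (free_cover M x).
  apply: (@free_hom_eq _ _ _ (phi \o free_lift s) (f \o free_cover M)) => t.
  by rewrite /= !free_lift_delta sE.
have dK y : free_cover M (free_d M 0 y) = 0.
  by apply/(@free_d_exact V M 0); exists y.
have [c cE] : exists c : {linear Free V (syzygy M 1) -> Ker phi},
    forall y, val (c y) = free_lift s (free_d M 0 y).
  apply: (linear_to_ker (u := free_lift s \o free_d M 0)) => y.
  by rewrite /= hE dK linear0.
have c0 y : c (free_d M 1 y) = 0.
  apply: val_inj; rewrite cE.
  have /free_d_exactS -> : exists w, free_d M 1 w = free_d M 1 y by exists y.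
  exact: linear0.
have [b bE] := Ext1_coboundary aExt c0.
pose valK : {linear Ker phi -> N} := val.
pose u : {linear Free V M -> N} := a \*: free_lift s \- (valK \o b).
have uE x : u x = a *: free_lift s x - val (b x) by [].
have u0 x : free_cover M x = 0 -> u x = 0.
  move=> /(@free_d_exact V M 0)[y <-].
  by rewrite uE bE -cE (linearZ_LR valK) subrr.
have [g gE] := linear_descent (@free_cover_surj V M) u0.
exists g => m; have [x <-] := free_cover_surj m.
have phi_val (z : Ker phi) : phi (val z) = 0.
  by apply/eqP; case: z.
by rewrite gE uE linearB linearZ /= phi_val subr0 hE.
Qed.

Lemma roots_iter (V : comPzRingType) (p : nat) (varpi : V) (r : nat -> V) m k :
  compatible_roots p varpi r -> r (m + k)%N ^+ (p ^ k) = r m.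
Proof.
move=> [_ rS].
by elim: k => [|k IHk]; rewrite ?addn0 // addnS expnS exprM rS.
Qed.

Lemma root_pow_add_double (V : comPzRingType) (p : nat) (varpi : V)
    (r : nat -> V) k (alpha : rat) :
  prime p -> compatible_roots p varpi r -> 0 < alpha -> in_Z_inv p alpha ->
  root_pow p r (1 / p%:R ^+ k + 2 * alpha)
    = root_pow p r alpha * (r k * root_pow p r alpha).
Proof.
move=> p_prime r_roots alpha_gt0 [a' [n alphaE]].
have p0 m : 0 < p%:R ^+ m :> rat by rewrite exprn_gt0 // ltr0n prime_gt0.
have a'_gt0 : 0 < a'.
  by move: alpha_gt0; rewrite alphaE pmulr_lgt0 ?invr_gt0 // ltr0z.
case: a' a'_gt0 alphaE => // a a_gt0 alphaE.
have -> : 1 / p%:R ^+ k + 2 * alpha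
    = (p ^ n + 2 * (a * p ^ k))%:R / p%:R ^+ (n + k).
  rewrite alphaE natrD !natrM !natrX exprD -[a%:~R]/(a%:R); field.
  by rewrite !lt0r_neq0.
have pn_gt0 m : (0 < p ^ m)%N by rewrite expn_gt0 prime_gt0.
rewrite alphaE !(root_powE _ p_prime r_roots) ?addn_gt0 ?pn_gt0 //.
(* r n and r k are both powers of the common root r (n + k). *)
rewrite exprD mul2n -addnn exprD mulnC exprM (roots_iter _ _ r_roots) addnC.
by rewrite (roots_iter _ _ r_roots) mulrCA.
Qed.

Theorem lemma4p7 (p : nat) (p_prime : prime p) (V : comPzRingType)
    (varpi : V) (varpi_reg : GRing.lreg varpi)
    (r : nat -> V) (r_roots : compatible_roots p varpi r)
    (M : lmodType V)
    (M_afg : almost_fin_gen (roots_ideal r) M)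
    (M_aproj : almost_projective (roots_ideal r) M)
    (N : lmodType V) (phi : {linear N -> M})
    (alpha : rat) (alpha_gt0 : 0 < alpha) (alpha_Zp : in_Z_inv p alpha)
    (coker_phi : annihilates [set root_pow p r alpha] (Coker phi)) :
  forall k : nat, (0 < k)%N ->
    exists g : {linear M -> N},
      forall m : M,
        phi (g m) = root_pow p r (1 / p%:R ^+ k + 2 * alpha) *: m.
Proof.
move=> k k_gt0; set t := root_pow p r alpha.
have rkI : roots_ideal r (r k).
  by exists k => //; exists (fun=> 1); rewrite big_ord1 /= scale1r.
have rkExt : annihilates [set r k] (Ext 1 M (Ker phi)).
  by move=> _ x ->; exact: M_aproj.
have tM m : exists n, phi n = (t \*: idfun) m.
  have /quot_pi_eq0/asboolP// : quot_pi (im_pred phi) (t *: m) = 0.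
  by rewrite linearZ; apply: coker_phi.
have [g gE] := scaled_lift rkExt tM.
exists (t \*: g) => m.
by rewrite /= linearZ /= gE /= !scalerA (root_pow_add_double _ p_prime r_roots) // mulrA.
Qed.
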